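(* Let $X$ be a linear space over $\mathbb{K}$, where $\mathbb{K}=\mathbb{R}$ or $\mathbb{K}=\mathbb{C}$, and let $s\in(0,1]$. Fix $n\ge 2$ and let $\rho_i$ be an $s$-convex semimodular on $X$ for each $i\in\{1,\dots,n-1\}$. Put $\rho=\max_{1\le i\le n-1}\rho_i$ and $X_\rho=\{x\in X:\rho(dx)<\infty\text{ for some }d>0\}$. Assume that $f:\mathbb{R}^n\to[0,+\infty)$ is a convex function such that $f(x)=0$ if and only if $x=0$. Assume furthermore that for any $x=(1,x_2,\dots,x_n)\in(\mathbb{R}_+)^n$ and $y=(1,y_2,\dots,y_n)\in(\mathbb{R}_+)^n$, if $x_j\le y_j$ for $j=2,\dots,n$, then $f(x)\le f(y)$. For $x\in X_\rho$ define $$\|x\|_f=\inf_{k>0}\left\{k\,f\left(e_1+\sum_{i=2}^n\rho_{i-1}\left(\frac{x}{k^{1/s}}\right)e_i\right)\right\}.$$ Then $\|\cdot\|_f$ is an $s$-norm (a norm if $s=1$) on $X_\rho$.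
   Context: $\mathbb{R}_+=[0,\infty)$ and $(e_i)_{i=1}^n$ is the standard basis of $\mathbb{R}^n$. A function $\rho:X\to[0,+\infty]$ is an $s$-convex semimodular if: (a) $\rho(0)=0$, and if $\rho(dx)=0$ for all $d\ge0$ then $x=0$; (b) $\rho(dx)=\rho(x)$ for all $x\in X$ and $d\in\mathbb{K}$ with $|d|=1$; (c) $\rho(ax+by)\le a^s\rho(x)+b^s\rho(y)$ for all $x,y\in X$ and $a,b\ge0$ with $a^s+b^s=1$. An $s$-norm on a linear space $Y$ over $\mathbb{K}$ is a function $\|\cdot\|:Y\to[0,\infty)$ such that $\|x\|=0$ iff $x=0$; $\|\lambda x\|=|\lambda|^s\|x\|$ for $\lambda\in\mathbb{K}$; and $\|x+y\|\le\|x\|+\|y\|$. Convention: $f\left(e_1+\sum_{i=2}^n t_ie_i\right)=+\infty$ whenever some $t_i=+\infty$. *)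

(* Defs.v *)
From mathcomp Require Import all_boot all_order all_algebra.
From mathcomp Require Import complex.
From mathcomp Require Import all_classical all_reals all_analysis.

Set Implicit Arguments.
Unset Strict Implicit.
Unset Printing Implicit Defensive.

Import Order.TTheory GRing.Theory Num.Theory.

Local Open Scope classical_set_scope.
Local Open Scope ring_scope.

Variant scalar_kind := RealScalars | ComplexScalars.

Definition scalars (R : realType) (k : scalar_kind) : numFieldType :=
  match k with
  | RealScalars => R : numFieldType
  | ComplexScalars => R[i] : numFieldType
  end.

Definition of_real (R : realType) (k : scalar_kind) : R -> scalars R k :=
  match k with
  | RealScalars => fun a => a
  | ComplexScalars => fun a => real_complex R a
  end.
Arguments of_real {R k} a.

(* The norm of R[i] takes its values in R[i]; this is the same number in R. *)
Definition modulus (R : realType) (k : scalar_kind) : scalars R k -> R :=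
  match k with
  | RealScalars => fun d => `|d|
  | ComplexScalars => fun d => complex.Re `|d|
  end.
Arguments modulus {R k} d.

Section Definitions.
Context {R : realType} {k : scalar_kind} {X : lmodType (scalars R k)}.

(* In \bar R, 0 * +oo = 0, so semimodular_convex is trivial when a = 0 or b = 0. *)
Record sconvex_semimodular (s : R) (rho : X -> \bar R) : Prop := {
  semimodular_ge0 : forall x, (0 <= rho x)%E;
  semimodular0 : rho 0 = 0%E;
  semimodular_eq0 : forall x,
    (forall d : R, 0 <= d -> rho (of_real d *: x) = 0%E) -> x = 0;
  semimodular_unit : forall (x : X) (d : scalars R k),
    modulus d = 1 -> rho (d *: x) = rho x;
  semimodular_convex : forall (x y : X) (a b : R),
    0 <= a -> 0 <= b -> a `^ s + b `^ s = 1 ->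
    (rho (of_real a *: x + of_real b *: y)%R
       <= (a `^ s)%:E * rho x + (b `^ s)%:E * rho y)%E }.

(* The neutral element -oo is harmless as soon as 0 < p. *)
Definition max_semimodular (p : nat) (rho : 'I_p -> X -> \bar R) (x : X)
    : \bar R :=
  \big[Order.max/-oo%E]_(i < p) rho i x.

Definition modular_space (rho : X -> \bar R) : set X :=
  [set x | exists2 d : R, 0 < d & (rho (of_real d *: x) < +oo)%E].

(* s-norms are the case h = (`^ s), norms the case h = id.  Carrying a norm
   includes being a linear space, hence the first field. *)
Record norm_on (h : R -> R) (Y : set X) (N : X -> \bar R) : Prop := {
  norm_on_linear : GRing.submod_closed [in Y];
  norm_on_ge0 : forall x, Y x -> (0 <= N x)%E;
  norm_on_lty : forall x, Y x -> (N x < +oo)%E;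
  norm_on_eq0 : forall x, Y x -> (N x = 0%E <-> x = 0);
  norm_onZ : forall (l : scalars R k) x, Y x ->
    N (l *: x) = ((h (modulus l))%:E * N x)%E;
  norm_onD : forall x y, Y x -> Y y -> (N (x + y)%R <= N x + N y)%E }.

Definition is_snorm_on (s : R) := norm_on (fun r => r `^ s).

Definition is_norm_on := norm_on id.

(* R^n is 'rV[R]_p.+1 with n = p + 1; this is e_1 + \sum_(2 <= i <= n) t_i e_i,
   the coordinates t_2, ..., t_n being indexed by 'I_p. *)
Definition affine_point (p : nat) (t : 'I_p -> R) : 'rV[R]_p.+1 :=
  delta_mx 0 ord0 + \sum_(i < p) t i *: delta_mx 0 (lift ord0 i).

Definition extended_value (p : nat) (f : 'rV[R]_p.+1 -> R)
    (t : 'I_p -> \bar R) : \bar R :=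
  if [exists i, t i == +oo%E] then +oo%E
  else (f (affine_point (fun i => fine (t i))))%:E.

Definition f_norm (s : R) (p : nat) (rho : 'I_p -> X -> \bar R)
    (f : 'rV[R]_p.+1 -> R) (x : X) : \bar R :=
  ereal_inf [set (c%:E * extended_value f
                    (fun i => rho i (of_real (c `^ s^-1)^-1 *: x)))%E
            | c in [set c : R | 0 < c]].

End Definitions.

(* Main.v *)
(* Write V_k(x) = f(e_1 + sum_i rho_(i-1)(x / k^(1/s)) e_i).  Scaling x by r > 0
   amounts to replacing k by r^s k, whence homogeneity.  Since
   (x + y) / (c + h)^(1/s) = a (x / c^(1/s)) + b (y / h^(1/s)) with
   a^s = c / (c + h) and b^s = h / (c + h), s-convexity of the rho_i, monotonicity
   and convexity of f give (c + h) V_(c+h)(x + y) <= c V_c(x) + h V_h(y), whence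
   the triangle inequality.  If x <> 0, some rho_i(d x) is positive, and
   s-convexity forces k rho_i(x / k^(1/s)) >= rho_i(d x) / d^s for small k;
   convexity of f along e_1 then keeps k V_k(x) away from 0. *)
Require Import Defs.
From mathcomp Require Import all_boot all_order all_algebra.
From mathcomp Require Import complex.
From mathcomp Require Import all_classical all_reals all_analysis.
From mathcomp Require Import ring lra.
Import Order.TTheory GRing.Theory Num.Theory.

Local Open Scope classical_set_scope.
Local Open Scope ring_scope.

(** * Real and complex scalars treated uniformly *)

Section Scalars.
Context {R : realType} {k : scalar_kind}.
Implicit Types (l : scalars R k).

Lemma of_real0 : of_real 0 = 0 :> scalars R k.
Proof. by case: k. Qed.

Lemma of_real1 : of_real 1 = 1 :> scalars R k.
Proof. by case: k. Qed.

Lemma of_realM (a b : R) : of_real (a * b) = of_real a * of_real b :> scalars R k.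
Proof. by case: k => //=; rewrite -rmorphM. Qed.

Lemma modulus0 : modulus (0 : scalars R k) = 0.
Proof.
case: k; first exact: normr0.
exact: (congr1 (@complex.Re R) (normr0 R[i])).
Qed.

Lemma modulus_ge0 l : 0 <= modulus l.
Proof.
case: k l => [l|l]; first exact: (normr_ge0 (l : R)).
by rewrite /modulus (normc_def l) sqrtr_ge0.
Qed.

(** Splits multiplication by [l] into a positive real dilation, governed by $s$-convexity, and a
    factor of modulus 1, which leaves semimodulars unchanged. *)
Lemma polar_decomposition l : l != 0 ->
  0 < modulus l /\ exists2 u : scalars R k, modulus u = 1 & l = of_real (modulus l) * u.
Proof.
have polar (K : numFieldType) (z : K) : z != 0 -> `|z / `|z| | = 1 /\ z = `|z| * (z / `|z|).
  move=> z0; split; last by rewrite mulrCA divff ?mulr1 ?normr_eq0.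
  by rewrite normrM normfV normr_id divff ?normr_eq0.
case: k l => [l l0|l l0]; have [nu lE] := polar _ _ l0.
  by split; [rewrite /modulus normr_gt0|exists (l / `|l|)].
(* In [R[i]] the norm is a complex number with zero imaginary part, hence the image of its real
   part. *)
have nlE : `|l| = (complex.Re `|l|)%:C%C by rewrite (normc_def l).
split; first by rewrite -(@ltcR R) -nlE (normr_gt0 (l : R[i])).
exists (l / `|l|); first by rewrite /modulus nu.
by rewrite {1}lE {1}nlE.
Qed.

End Scalars.

(** * Semimodulars under real dilations *)

Section Semimodulars.
Context {R : realType} {k : scalar_kind} {X : lmodType (scalars R k)}.
Context {s : R} (s_gt0 : 0 < s).
Implicit Types (x y : X).

Lemma powRVK (a : R) : 0 <= a -> (a `^ s^-1) `^ s = a.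
Proof. by move=> a0; rewrite -powRrM mulVf ?gt_eqF// powRr1. Qed.

Lemma powRKV (a : R) : 0 <= a -> (a `^ s) `^ s^-1 = a.
Proof. by move=> a0; rewrite -powRrM divff ?gt_eqF// powRr1. Qed.

(** This is $s$-convexity with second point 0 and second weight $b=(1-c^s)^{1/s}$, since
    $\rho(0)=0$. *)
Lemma semimodular_le_scale {rho : X -> \bar R} (rhoP : sconvex_semimodular s rho)
    (c : R) x : 0 <= c <= 1 -> (rho (of_real c *: x) <= (c `^ s)%:E * rho x)%E.
Proof.
move=> /andP[c0 c1].
have cs1 : c `^ s <= 1.
  by rewrite -[leRHS](congr1 (@^~ s) (powR1 R)) ge0_ler_powR ?nnegrE// ltW.
have /(_ x 0) := semimodular_convex rhoP _ _ c0 (powR_ge0 (1 - c `^ s) s^-1).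
rewrite scaler0 addr0 (semimodular0 rhoP) mule0 adde0; apply.
by rewrite powRVK ?subr_ge0// addrC subrK.
Qed.

(** * The modular space is a linear subspace *)

Context {p : nat} {rho : 'I_p -> X -> \bar R}.
Context (rhoP : forall i, sconvex_semimodular s (rho i)).

Lemma modular_spaceP x : modular_space (max_semimodular rho) x <->
  exists2 d : R, 0 < d & forall i, (rho i (of_real d *: x) < +oo)%E.
Proof.
split=> -[d d0 h]; exists d => //.
  by move=> i; move/bigmax_ltP : h => -[_]; exact.
by apply/bigmax_ltP; split.
Qed.

Lemma modular_space_lower x (d d' : R) : 0 < d' <= d ->
  (forall i, rho i (of_real d *: x) < +oo)%E ->
  (forall i, rho i (of_real d' *: x) < +oo)%E.
Proof.
move=> /andP[d'0 d'd] h i; have d0 := lt_le_trans d'0 d'd.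
have -> : of_real d' *: x = of_real (d' / d) *: (of_real d *: x).
  by rewrite scalerA -of_realM divfK ?gt_eqF.
apply: le_lt_trans (semimodular_le_scale (rhoP i) _ _ _) _.
  by rewrite divr_ge0 ?(ltW d'0) ?(ltW d0)//= ler_pdivrMr// mul1r.
by apply: lte_mul_pinfty => //; rewrite lee_fin powR_ge0.
Qed.

Lemma modular_space_add x y :
  modular_space (max_semimodular rho) x -> modular_space (max_semimodular rho) y ->
  modular_space (max_semimodular rho) (x + y).
Proof.
move=> /modular_spaceP[d d0 dx] /modular_spaceP[e e0 ey]; apply/modular_spaceP.
(* At the common scale $m$ both points have finite semimodulars; since $h^s=1/2$, $hm(x+y)$ is an
   $s$-convex combination of $mx$ and $my$ with equal weights. *)
pose m := Num.min d e; have m0 : 0 < m by rewrite lt_min d0.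
pose h : R := 2^-1 `^ s^-1.
exists (h * m); first by rewrite mulr_gt0// powR_gt0 ?invr_gt0.
move=> i; rewrite of_realM -scalerA !scalerDr.
have /(_ (of_real m *: x) (of_real m *: y) h h) := semimodular_convex (rhoP i).
rewrite powR_ge0 !powRVK ?invr_ge0//= => /(_ isT isT).
have h2 : 2^-1 + 2^-1 = 1 :> R by lra.
move=> /(_ h2) /le_lt_trans; apply.
have hx : (rho i (of_real m *: x) < +oo)%E.
  by apply: (modular_space_lower _ _ _ _ dx i); rewrite m0 ge_min lexx.
have hy : (rho i (of_real m *: y) < +oo)%E.
  by apply: (modular_space_lower _ _ _ _ ey i); rewrite m0 ge_min lexx orbT.
by rewrite lte_add_pinfty ?lte_mul_pinfty ?lee_fin ?invr_ge0.
Qed.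

Lemma modular_space0 : modular_space (max_semimodular rho) 0.
Proof.
apply/modular_spaceP; exists 1 => // i.
by rewrite scaler0 (semimodular0 (rhoP i)).
Qed.

Lemma modular_space_scale (l : scalars R k) x :
  modular_space (max_semimodular rho) x -> modular_space (max_semimodular rho) (l *: x).
Proof.
have [->|l0] := eqVneq l 0; first by rewrite scale0r => _; exact: modular_space0.
have [r0 [u u1 ->]] := polar_decomposition l l0; set r := modulus l in r0 *.
(* With $l=ru$, $(d/r)\,l\,x=u(dx)$, and $u$ has modulus 1. *)
move=> /modular_spaceP[d d0 dx]; apply/modular_spaceP; exists (d / r).
  by rewrite divr_gt0.
move=> i; rewrite scalerA mulrA -of_realM divfK ?gt_eqF// mulrC -scalerA.
by rewrite (semimodular_unit (rhoP i)).
Qed.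

Lemma modular_space_submod :
  GRing.submod_closed [in modular_space (max_semimodular rho)].
Proof.
split=> [|a x y]; rewrite !inE; first exact: modular_space0.
by move=> hx hy; apply: modular_space_add => //; exact: modular_space_scale.
Qed.

End Semimodulars.

(** * The convex function on the slice $e_1+t$ and its extended values *)

Section ConvexFunction.
Context {R : realType} {p : nat} {f : 'rV[R]_p.+1 -> R}.
Context (f_ge0 : forall x, 0 <= f x)
  (f_convex : convex_function [set: convex_lmodType 'rV[R]_p.+1] f)
  (f_eq0 : forall x, f x = 0 <-> x = 0)
  (f_mono : forall x y : 'rV[R]_p.+1,
     (forall j, 0 <= x 0 j) -> (forall j, 0 <= y 0 j) ->
     x 0 ord0 = 1 -> y 0 ord0 = 1 ->
     (forall j, j != ord0 -> x 0 j <= y 0 j) -> f x <= f y).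

Lemma convex_combination_le (t : R) x y : 0 <= t <= 1 ->
  f (t *: x + (1 - t) *: y) <= t * f x + (1 - t) * f y.
Proof.
move=> /andP[t0 t1].
by have := f_convex (Itv01 t0 t1) x y; apply; rewrite inE.
Qed.

Lemma convex_scale_le (t : R) x : 0 <= t <= 1 -> f (t *: x) <= t * f x.
Proof.
move=> t01; have := convex_combination_le t x 0 t01.
by rewrite scaler0 addr0 (f_eq0 0).2// mulr0 addr0.
Qed.

Lemma convex_gt0 x : x != 0 -> 0 < f x.
Proof. by move=> x0; rewrite lt0r f_ge0 andbT; apply: contra_neq x0 => /f_eq0. Qed.

Lemma affine_point0 (t : 'I_p -> R) : affine_point t 0 ord0 = 1.
Proof.
rewrite !mxE summxE !eqxx big1 ?addr0// => i _.
by rewrite !mxE /= mulr0.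
Qed.

Lemma affine_point_lift (t : 'I_p -> R) i : affine_point t 0 (lift ord0 i) = t i.
Proof.
rewrite !mxE summxE /= add0r (bigD1 i)//= !mxE !eqxx mulr1.
rewrite big1 ?addr0// => j ji.
by rewrite !mxE (inj_eq lift_inj) [i == j]eq_sym (negPf ji) mulr0.
Qed.

Lemma affine_point_neq0 (t : 'I_p -> R) : affine_point t != 0.
Proof.
apply/eqP => /rowP /(_ ord0); rewrite affine_point0 mxE.
exact/eqP/oner_neq0.
Qed.

Lemma row_combination (a b : R) (x y : 'rV[R]_p.+1) j :
  (a *: x + b *: y) 0 j = a * x 0 j + b * y 0 j.
Proof. by rewrite !mxE. Qed.

Lemma affine_point_combination (a : R) (t u : 'I_p -> R) :
  affine_point (fun i => a * t i + (1 - a) * u i) =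
  a *: affine_point t + (1 - a) *: affine_point u.
Proof.
apply/rowP => j; rewrite row_combination.
case: (unliftP ord0 j) => [i|] ->; rewrite ?affine_point_lift ?affine_point0//.
by rewrite !mulr1 addrC subrK.
Qed.

Lemma le_affine_point (t u : 'I_p -> R) : (forall i, 0 <= t i <= u i) ->
  f (affine_point t) <= f (affine_point u).
Proof.
move=> tu; apply: f_mono; rewrite ?affine_point0// => j;
  case: (unliftP ord0 j) => [i|] ->; rewrite ?affine_point0// ?affine_point_lift.
- by case/andP: (tu i).
- by case/andP: (tu i) => /le_trans; apply.
- by case/andP: (tu i).
Qed.

(** Supports case analysis on nonnegative coordinates: in the finite case they come as nonnegative
    reals [r], so [fine] disappears and monotonicity of [f] applies. *)
Variant extended_value_spec (t : 'I_p -> \bar R) : \bar R -> Prop :=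
  | ExtendedValueInfinite i of t i = +oo%E : extended_value_spec t +oo%E
  | ExtendedValueFinite (r : 'I_p -> R) of (forall i, t i = (r i)%:E)
      & (forall i, 0 <= r i) : extended_value_spec t (f (affine_point r))%:E.

Lemma extended_valueP (t : 'I_p -> \bar R) : (forall i, 0 <= t i)%E ->
  extended_value_spec t (extended_value f t).
Proof.
move=> t0; rewrite /extended_value; case: ifPn => [/existsP[i /eqP]|].
  exact: ExtendedValueInfinite.
rewrite negb_exists => /forallP tfin.
apply: ExtendedValueFinite => i; last exact: fine_ge0.
by rewrite fineK// ge0_fin_numE// lt_neqAle tfin leey.
Qed.

Lemma extended_value_ge0 (t : 'I_p -> \bar R) : (0 <= extended_value f t)%E.
Proof. by rewrite /extended_value; case: ifP => _; rewrite ?leey// lee_fin. Qed.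

Lemma extended_value_lty (t : 'I_p -> \bar R) :
  (forall i, t i < +oo)%E -> (extended_value f t < +oo)%E.
Proof.
move=> tfin; rewrite /extended_value; case: ifP => [/existsP[i /eqP ti]|_].
  by have := tfin i; rewrite ti ltxx.
by rewrite ltry.
Qed.

Lemma le_extended_value (t u : 'I_p -> \bar R) : (forall i, 0 <= t i <= u i)%E ->
  (extended_value f t <= extended_value f u)%E.
Proof.
move=> tu; case: (extended_valueP u) => [i|i ui|r ur r0].
- by have /andP[/le_trans] := tu i; apply.
- by rewrite leey.
case: (extended_valueP t) => [i|i ti|q tq q0]; first by have /andP[] := tu i.
  by have := tu i; rewrite ti ur andbC leye_eq.
rewrite lee_fin; apply: le_affine_point => i.
by rewrite q0 -lee_fin -tq -ur; have /andP[] := tu i.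
Qed.

(** Both weights are positive, so an infinite coordinate of [t] or [u] makes the right-hand side
    infinite; otherwise this is convexity of [f], the slice $e_1+t$ being affine. *)
Lemma extended_value_combination (a : R) (t u : 'I_p -> \bar R) : 0 < a < 1 ->
  (forall i, 0 <= t i)%E -> (forall i, 0 <= u i)%E ->
  (extended_value f (fun i => a%:E * t i + (1 - a)%:E * u i)
   <= a%:E * extended_value f t + (1 - a)%:E * extended_value f u)%E.
Proof.
move=> /andP[a0 a1] t0 u0; have b0 : 0 < 1 - a by rewrite subr_gt0.
have Ev0 v c : 0 < c -> (0 <= c%:E * extended_value f v)%E.
  by move=> c0; rewrite mule_ge0 ?extended_value_ge0// lee_fin ltW.
case: (extended_valueP t t0) => [i ti|r tr r0].
  rewrite gt0_muley ?lte_fin// addye ?leey//.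
  by rewrite gt_eqF// (lt_le_trans (ltNyr 0)) ?Ev0.
case: (extended_valueP u u0) => [i ui|q uq q0].
  by rewrite gt0_muley ?lte_fin// addey ?leey.
rewrite (_ : (fun i => _) = fun i => (a * r i + (1 - a) * q i)%:E); last first.
  by apply/funext => i; rewrite tr uq -!EFinM -EFinD.
rewrite /extended_value ifF; last by apply/negbTE; rewrite negb_exists; apply/forallP.
rewrite -!EFinM -EFinD lee_fin affine_point_combination.
by apply: convex_combination_le; rewrite !ltW.
Qed.

(* Convexity between k (e_1 + t) and - k e_1 yields
   2 f(c e_i / 2) <= k f(e_1 + t) + k f(- e_1) when k <= 1 and k t >= c e_i, so
   the values k f(e_1 + t) stay away from 0 when k is small; when k is large they
   are at least k f(e_1). *)
Lemma extended_value_lower_bound (i : 'I_p) (c k0 : R) : 0 < c -> 0 < k0 ->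
  exists2 e : R, 0 < e & forall (k : R) (t : 'I_p -> \bar R), 0 < k ->
    (forall j, 0 <= t j)%E -> (k <= k0 -> (c%:E <= k%:E * t i)%E) ->
    (e%:E <= k%:E * extended_value f t)%E.
Proof.
move=> c0 k00.
pose v : 'rV[R]_p.+1 := (c / 2) *: delta_mx 0 (lift ord0 i).
have v0 : v != 0.
  apply/eqP => /rowP /(_ (lift ord0 i)); rewrite !mxE !eqxx mulr1.
  by apply/eqP; rewrite gt_eqF// divr_gt0.
pose w : 'rV[R]_p.+1 := - delta_mx 0 ord0.
pose z := affine_point (fun=> 0) : 'rV[R]_p.+1.
have fv0 : 0 < f v := convex_gt0 _ v0.
have fz0 : 0 < f z by apply/convex_gt0/affine_point_neq0.
have fw1 : 0 < f w + 1 by rewrite ltr_wpDl.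
(* Threshold between small and large [k]. For $k\le d$: $k\le1$ lets [convex_scale_le] apply, $k\le
   k_0$ gives $c\le k t_i$, and the last bound gives $kf(w)+k\le f(v)$; the added 1 makes the
   denominator positive. *)
pose d := Num.min 1 (Num.min k0 (f v / (f w + 1))).
have d0 : 0 < d by rewrite !lt_min ltr01 k00 divr_gt0.
exists (Num.min (f v) (d * f z)); first by rewrite lt_min fv0 mulr_gt0.
move=> k t kgt0 t0 kt; case: (extended_valueP t t0) => [j tj|r tr r0].
  by rewrite gt0_muley ?leey.
rewrite -EFinM lee_fin ge_min; have [kd|/ltW dk] := leP k d; last first.
  apply/orP; right; apply: ler_pM => //; first exact: ltW.
  by apply: le_affine_point => j; rewrite lexx r0.
apply/orP; left.
have [k1 [kk0 kf]] : k <= 1 /\ k <= k0 /\ k <= f v / (f w + 1).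
  by move: kd; rewrite !le_min => /and3P[].
have ckr : c <= k * r i by rewrite -lee_fin EFinM -tr kt.
(* Chosen so that $k(e_1+q)=ke_1+ce_i$; its midpoint with $kw=-ke_1$ is then $v$, independent of
   [k]. *)
pose q j : R := if j == i then c / k else 0.
have qr : f (affine_point q) <= f (affine_point r).
  apply: le_affine_point => j; rewrite /q; case: eqP => [->|_].
    by rewrite (divr_ge0 (ltW c0) (ltW kgt0)) ler_pdivrMr// mulrC.
  by rewrite lexx r0.
have k01 : 0 <= k <= 1 by rewrite (ltW kgt0).
have half : 0 <= (2^-1 : R) <= 1 by apply/andP; split; lra.
have vE : v = 2^-1 *: (k *: affine_point q) + (1 - 2^-1) *: (k *: w).
  apply/rowP => j; rewrite !scalerA row_combination.
  case: (unliftP ord0 j) => [l|] ->; rewrite ?affine_point_lift ?affine_point0 !mxE /=.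
    rewrite /q; case: (eqVneq l i) => [->|li]; first by rewrite eqxx mulr1n; field; exact: lt0r_neq0.
    by rewrite (inj_eq lift_inj) (negPf li) mulr0n; ring.
  by field.
(* These inequalities chain to $2f(v)\le kf(e_1+r)+kf(w)\le kf(e_1+r)+f(v)-k$, hence $f(v)\le
   kf(e_1+r)$. *)
have := convex_combination_le _ (k *: affine_point q) (k *: w) half.
rewrite -vE.
have := convex_scale_le k (affine_point q) k01.
have := convex_scale_le k w k01.
have : k * f (affine_point q) <= k * f (affine_point r) by rewrite ler_pM2l.
have : k * f w + k <= f v by rewrite -{2}[k]mulr1 -mulrDr -ler_pdivlMr.
have -> : 1 - 2^-1 = 2^-1 :> R by lra.
move: kgt0.
lra.
Qed.

End ConvexFunction.

(** * The infimum: finiteness and homogeneity *)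

Section FNorm.
Context {R : realType} {k : scalar_kind} {X : lmodType (scalars R k)}.
Context {s : R} (s_gt0 : 0 < s) {p : nat} {rho : 'I_p -> X -> \bar R}.
Context (rhoP : forall i, sconvex_semimodular s (rho i)).
Context {f : 'rV[R]_p.+1 -> R} (f_ge0 : forall x, 0 <= f x).
Implicit Types x y : X.

(** The quantity $V_c(x)$, so that [f_norm] is the infimum of $c\,V_c(x)$ over $c>0$. *)
Let F (c : R) x :=
  extended_value f (fun i => rho i (of_real (c `^ s^-1)^-1 *: x)).

Let rho_ge0 i x : (0 <= rho i x)%E := semimodular_ge0 (rhoP i) x.

Let F_ge0 c x : (0 <= F c x)%E := extended_value_ge0 f_ge0 _.

Lemma f_norm_le c x : 0 < c -> (f_norm s rho f x <= c%:E * F c x)%E.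
Proof. by move=> c0; apply: ereal_inf_lbound; exists c. Qed.

Lemma le_f_norm (M : \bar R) x :
  (forall c, 0 < c -> (M <= c%:E * F c x)%E) -> (M <= f_norm s rho f x)%E.
Proof. by move=> h; apply: le_ereal_inf_tmp => _ [c c0 <-]; exact: h. Qed.

Lemma f_norm_ge0 x : (0 <= f_norm s rho f x)%E.
Proof.
by apply: le_f_norm => c c0; rewrite mule_ge0// lee_fin ltW.
Qed.

Lemma f_norm_lty x : modular_space (max_semimodular rho) x ->
  (f_norm s rho f x < +oo)%E.
Proof.
move=> /modular_spaceP[d d0 dx].
(* For $c=d^{-s}$ one has $x/c^{1/s}=dx$, where all the semimodulars are finite. *)
have c0 : 0 < d^-1 `^ s by rewrite powR_gt0 ?invr_gt0.
apply: le_lt_trans (f_norm_le _ x c0) _.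
apply: lte_mul_pinfty => //; first by rewrite lee_fin ltW.
by apply: extended_value_lty => i; rewrite powRKV ?invrK// invr_ge0 ltW.
Qed.

Lemma f_norm_unit (u : scalars R k) x : modulus u = 1 ->
  f_norm s rho f (u *: x) = f_norm s rho f x.
Proof.
move=> u1; rewrite /f_norm; congr ereal_inf; apply: eq_imagel => c _.
congr (_ * extended_value f _)%E; apply/funext => i.
by rewrite scalerA mulrC -scalerA (semimodular_unit (rhoP i)).
Qed.

(** The parameter $r^sc$ for $rx$ yields the same argument as $c$ for $x$, because
    $rx/(r^sc)^{1/s}=x/c^{1/s}$. *)
Lemma f_norm_le_scale (r : R) x : 0 < r ->
  (f_norm s rho f (of_real r *: x) <= (r `^ s)%:E * f_norm s rho f x)%E.
Proof.
move=> r0; have rs0 : 0 < r `^ s by exact: powR_gt0.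
rewrite -lee_pdivrMl//; apply: le_f_norm => c c0; rewrite lee_pdivrMl//.
rewrite muleA -EFinM.
have /le_trans := f_norm_le _ (of_real r *: x) (mulr_gt0 rs0 c0); apply.
rewrite /F (_ : (fun i => rho i _) = fun i => rho i (of_real (c `^ s^-1)^-1 *: x))//.
apply/funext => i; rewrite scalerA -of_realM powRM ?(ltW c0) ?(ltW rs0)//.
by rewrite powRKV ?(ltW r0)// invfM mulrAC mulVf ?mul1r// gt_eqF.
Qed.

(** The reverse inequality is the previous bound for $r^{-1}$ at the point $rx$. *)
Lemma f_norm_scale_gt0 (r : R) x : 0 < r ->
  f_norm s rho f (of_real r *: x) = ((r `^ s)%:E * f_norm s rho f x)%E.
Proof.
move=> r0; apply/le_anti; rewrite f_norm_le_scale//=.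
have := f_norm_le_scale r^-1 (of_real r *: x).
rewrite invr_gt0 => /(_ r0).
rewrite scalerA -of_realM mulVf ?gt_eqF// of_real1 scale1r.
by rewrite -powR_inv1 ?(ltW r0)// -powRrM mulN1r powRN lee_pdivlMl ?powR_gt0.
Qed.

(** Dilating 0 by $2^{1/s}$ shows that the value $N$ at 0 satisfies $N=2N$; being finite, it
    vanishes. *)
Lemma f_norm0 : f_norm s rho f 0 = 0%E.
Proof.
have N0 := f_norm_ge0 0.
have Nfin : (f_norm s rho f 0 \is a fin_num).
  by rewrite ge0_fin_numE// f_norm_lty//; exact: modular_space0.
have := f_norm_scale_gt0 (2 `^ s^-1) 0 (powR_gt0 _ (ltr0Sn R 1)).
rewrite scaler0 powRVK// -(fineK Nfin) -EFinM => -[N2].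
by congr (_%:E); lra.
Qed.

Lemma f_normZ (l : scalars R k) x :
  f_norm s rho f (l *: x) = ((modulus l `^ s)%:E * f_norm s rho f x)%E.
Proof.
have [->|l0] := eqVneq l 0.
  by rewrite scale0r f_norm0 modulus0 powR0 ?mul0e// gt_eqF.
have [r0 [u u1 lE]] := polar_decomposition l l0.
by rewrite {1}lE -scalerA f_norm_scale_gt0// f_norm_unit.
Qed.

(** * Definiteness and the triangle inequality *)

Context (f_convex : convex_function [set: convex_lmodType 'rV[R]_p.+1] f)
  (f_eq0 : forall z, f z = 0 <-> z = 0)
  (f_mono : forall z w : 'rV[R]_p.+1,
     (forall j, 0 <= z 0 j) -> (forall j, 0 <= w 0 j) ->
     z 0 ord0 = 1 -> w 0 ord0 = 1 ->
     (forall j, j != ord0 -> z 0 j <= w 0 j) -> f z <= f w).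

Lemma f_norm_gt0 x : (0 < p)%N -> x != 0 -> (0 < f_norm s rho f x)%E.
Proof.
move=> p0 x0; pose i := Ordinal p0.
have [d d0 rd] : exists2 d : R, 0 < d & (0 < rho i (of_real d *: x))%E.
  apply: contrapT => h; move/eqP : x0; apply.
  apply: (semimodular_eq0 (rhoP i)) => d; rewrite le_eqVlt => /predU1P[<-|d0].
    by rewrite of_real0 scale0r (semimodular0 (rhoP i)).
  apply/le_anti; rewrite rho_ge0 andbT leNgt; apply/negP => rd.
  by apply: h; exists d.
(* The semimodular may be infinite at $dx$, so a positive real lower bound is extracted. *)
have [c0 c00 c0r] : exists2 c : R, 0 < c & (c%:E <= rho i (of_real d *: x))%E.
  case: (rho i _) rd => [r||//]; first by rewrite lte_fin => r0; exists r.
  by exists 1; rewrite ?leey.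
have ds0 : 0 < d `^ s by exact: powR_gt0.
(* The threshold $d^{-s}$ is where $dc^{1/s}\le1$: below it, $dx=(dc^{1/s})(x/c^{1/s})$ is a
   contraction of $x/c^{1/s}$, so $\rho_i(dx)\le d^sc\,\rho_i(x/c^{1/s})$. *)
have [e e0 eP] := extended_value_lower_bound f_ge0 f_convex f_eq0 f_mono i
  (c0 / d `^ s) (d `^ s)^-1 (divr_gt0 c00 ds0) (ltac:(by rewrite invr_gt0)).
apply: (@lt_le_trans _ _ e%:E); first by rewrite lte_fin.
apply: le_f_norm => c cgt0; apply: eP => // cd.
rewrite mulrC EFinM lee_pdivrMl// muleA -EFinM (le_trans c0r)//.
have cs0 : 0 < c `^ s^-1 by exact: powR_gt0.
have dc0 : 0 <= d * c `^ s^-1 by rewrite mulr_ge0// ltW.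
have dcE : (d * c `^ s^-1) `^ s = d `^ s * c.
  by rewrite powRM ?(ltW d0) ?(ltW cs0)// powRVK// ltW.
rewrite (_ : of_real d *: x =
    of_real (d * c `^ s^-1) *: (of_real (c `^ s^-1)^-1 *: x)); last first.
  by rewrite scalerA -of_realM mulfK// gt_eqF.
rewrite -dcE; apply: semimodular_le_scale => //; rewrite dc0/=.
have /(ge0_ler_powR _) : d `^ s * c <= 1 by rewrite mulrC -ler_pdivlMr// div1r.
rewrite -[leLHS](powRKV s_gt0)// dcE -[leRHS](congr1 (@^~ s^-1) (powR1 R)).
by apply; rewrite ?nnegrE ?invr_ge0 ?mulr_ge0// ltW.
Qed.

Lemma f_norm_triangle x y :
  modular_space (max_semimodular rho) x -> modular_space (max_semimodular rho) y ->
  (f_norm s rho f (x + y)%R <= f_norm s rho f x + f_norm s rho f y)%E.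
Proof.
move=> xX yX.
(* Bound for independent parameters $c$ and $h$; the two infima are taken afterwards, one at a
   time. *)
have add_le c h : 0 < c -> 0 < h ->
    (f_norm s rho f (x + y)%R <= c%:E * F c x + h%:E * F h y)%E.
  move=> c0 h0; have ch0 : 0 < c + h by rewrite addr_gt0.
  pose a := c / (c + h).
  have aE : 1 - a = h / (c + h) by rewrite /a; field; exact: lt0r_neq0.
  have a0 : 0 < a by rewrite divr_gt0.
  have b0 : 0 < 1 - a by rewrite aE divr_gt0.
  apply: le_trans (f_norm_le _ _ ch0) _.
  (* Used for $d=c$ and $d=h$, this exhibits $(x+y)/(c+h)^{1/s}$ as an $s$-convex combination whose
     weights have $s$-th powers $a$ and $1-a$. *)
  have rescale (d : R) (z : X) : 0 < d -> of_real ((c + h) `^ s^-1)^-1 *: z =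
      of_real ((d / (c + h)) `^ s^-1) *: (of_real (d `^ s^-1)^-1 *: z).
    move=> d0; rewrite scalerA -of_realM; congr (of_real _ *: _).
    have ds0 : d `^ s^-1 != 0 by rewrite gt_eqF// powR_gt0.
    rewrite powRM ?invr_ge0 ?(ltW d0) ?(ltW ch0)//.
    rewrite mulrAC divff// mul1r -powR_inv1 ?powR_ge0// powRAC powR_inv1//.
    exact: ltW.
  have comb : (F (c + h) (x + y) <= a%:E * F c x + (1 - a)%:E * F h y)%E.
    apply: le_trans (extended_value_combination f_ge0 f_convex a _ _ _ _ _) => //.
      apply: (le_extended_value f_mono) => i; rewrite rho_ge0/=.
      rewrite scalerDr (rescale c)// (rescale h)// -aE -/a.
      have := semimodular_convex (rhoP i) (of_real (c `^ s^-1)^-1 *: x)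
        (of_real (h `^ s^-1)^-1 *: y) (powR_ge0 a s^-1) (powR_ge0 (1 - a) s^-1).
      by rewrite (powRVK s_gt0 _ (ltW a0)) (powRVK s_gt0 _ (ltW b0)); apply; rewrite addrC subrK.
    by rewrite a0 -subr_gt0.
  rewrite (le_trans (lee_wpmul2l _ comb)) ?lee_fin ?(ltW ch0)//.
  rewrite muleDr//; last by apply: ge0_adde_def; rewrite inE mule_ge0// lee_fin ltW.
  rewrite !muleA -!EFinM aE /a ![(c + h) * _]mulrC !divfK ?gt_eqF//.
(* Moving a term across an inequality in [\bar R] requires it to be finite: this holds for the value
   at [y], while an infinite $c\,V_c(x)$ makes the bound trivial. *)
have yfin : f_norm s rho f y \is a fin_num.
  by rewrite ge0_fin_numE ?f_norm_ge0 ?f_norm_lty.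
rewrite -leeBlDr//; apply: le_f_norm => c c0; rewrite leeBlDr//.
have [cFfin|] := boolP (c%:E * F c x \is a fin_num)%E; last first.
  rewrite ge0_fin_numE ?mule_ge0 ?lee_fin ?(ltW c0)// -leNgt leye_eq => /eqP ->.
  by rewrite addye ?leey// gt_eqF// (lt_le_trans (ltNyr 0)) ?f_norm_ge0.
by rewrite -leeBlDl//; apply: le_f_norm => h h0; rewrite leeBlDl// add_le.
Qed.

Lemma f_norm_snorm : (0 < p)%N ->
  is_snorm_on s (modular_space (max_semimodular rho)) (f_norm s rho f).
Proof.
move=> p0; split.
- exact: (modular_space_submod s_gt0 rhoP).
- by move=> x _; exact: f_norm_ge0.
- exact: f_norm_lty.
- move=> x _; split=> [Nx0|->]; last exact: f_norm0.
  apply/eqP; apply: contraT => /(f_norm_gt0 _ p0).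
  by rewrite Nx0 ltxx.
- by move=> l x _; exact: f_normZ.
- exact: f_norm_triangle.
Qed.

End FNorm.

(** The homogeneity factors agree because $r^1=r$ for $r\ge0$ and moduli are nonnegative. *)
Lemma snorm_on_norm_on {R : realType} {k : scalar_kind} {X : lmodType (scalars R k)}
    (Y : set X) (N : X -> \bar R) : is_snorm_on 1 Y N -> is_norm_on Y N.
Proof.
case=> Ylin N0 Nfin Neq0 NZ ND; split=> // l x Yx.
by rewrite NZ//= powRr1// modulus_ge0.
Qed.

Theorem theorem3p2 (R : realType) (k : scalar_kind)
    (X : lmodType (scalars R k)) (s : R) (s_gt0 : 0 < s) (s_le1 : s <= 1)
    (p : nat) (n_ge2 : (2 <= p.+1)%N)
    (rho : 'I_p -> X -> \bar R)
    (rho_semimodular : forall i, sconvex_semimodular s (rho i))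
    (f : 'rV[R]_p.+1 -> R)
    (f_ge0 : forall x, 0 <= f x)
    (f_convex : convex_function [set: convex_lmodType 'rV[R]_p.+1] f)
    (f_eq0 : forall x, f x = 0 <-> x = 0)
    (f_mono : forall x y : 'rV[R]_p.+1,
       (forall j, 0 <= x 0 j) -> (forall j, 0 <= y 0 j) ->
       x 0 ord0 = 1 -> y 0 ord0 = 1 ->
       (forall j, j != ord0 -> x 0 j <= y 0 j) -> f x <= f y) :
  is_snorm_on s (modular_space (max_semimodular rho)) (f_norm s rho f) /\
  (s = 1 ->
   is_norm_on (modular_space (max_semimodular rho)) (f_norm s rho f)).
Proof.
have snorm := f_norm_snorm s_gt0 rho_semimodular f_ge0 f_convex f_eq0 f_mono n_ge2.
by split=> // s1; apply: snorm_on_norm_on; rewrite -s1.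
Qed.
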